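(* Let $\lambda$ be a positive integer and let $p$ be a prime number with $p>3\lambda$. Let $k$ be an algebraically closed field of characteristic $p$. Then there is no space $L_{\lambda p,2}$ over $k$.
   Context: Meromorphic differential forms on $\mathbb{P}^1_k$ are written $f(X)\,dX$ with $f\in k(X)$; the order at $a\in k$ is $\mathrm{ord}_a(f)$ and the order at $\infty$ is $\mathrm{ord}_0(f(1/X))-2$. A form $\omega$ is logarithmic if $\omega=dF/F$ for some nonzero $F\in k(X)$ (equivalently, all its poles are simple with residues in $\mathbb{F}_p^\times$). For positive integers $m,n$, a space $L_{m+1,n}$ is an $n$-dimensional $\mathbb{F}_p$-vector space $\Omega$ of meromorphic differential forms on $\mathbb{P}^1_k$ such that every nonzero $\omega\in\Omega$ is logarithmic and has a unique zero, which is located at $\infty$ and has order $m-1$. *)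

(* Defs.v *)
From HB Require Import structures.
From mathcomp Require Import all_boot all_order all_algebra.

Set Implicit Arguments.
Unset Strict Implicit.
Unset Printing Implicit Defensive.

Import GRing.Theory.
Local Open Scope ring_scope.
Local Open Scope quotient_scope.

(* k(X), with the notation x%:F for the embedding of k[X]. *)
Notation ratfun k := {fraction {poly k}}.
Notation "x %:F" := (@FracField.tofrac _ x) : ring_scope.

Section RationalFunctions.
Variable k : fieldType.
Implicit Types (f : ratfun k) (a : k).

(* A representative of f as a quotient of polynomials; it need not be in lowest
   terms, but the values of the functions below do not depend on the choice. *)
Definition rnum f : {poly k} := \n_(repr f).
Definition rden f : {poly k} := \d_(repr f).

Definition rderiv f : ratfun k :=
  ((rnum f)^`() * rden f - rnum f * (rden f)^`())%:F / (rden f ^+ 2)%:F.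

(* p(1/X) as an element of k(X). *)
Definition poly_at_Xinv (p : {poly k}) : ratfun k :=
  (map_poly (fun c : k => (c%:P)%:F) p).[('X%:F)^-1].

(* f(1/X) *)
Definition rat_at_Xinv f : ratfun k :=
  poly_at_Xinv (rnum f) / poly_at_Xinv (rden f).

(* ord_a(f), meaningful only for f != 0. *)
Definition ord_rat a f : int := (mup a (rnum f))%:Z - (mup a (rden f))%:Z.

(* From here on f stands for the meromorphic differential form f(X) dX on P^1,
   and a point of P^1 is an element of option k, None being infinity. *)
Definition ord_form (P : option k) f : int :=
  if P is Some a then ord_rat a f else ord_rat 0 (rat_at_Xinv f) - 2.

Definition logarithmic f : Prop :=
  exists F : ratfun k, F != 0 /\ f = rderiv F / F.

(* For m > 1 the second condition makes infinity a zero, hence the unique one;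
   for m = 1 there is no zero at all ("a zero of order 0"). *)
Definition unique_zero_at_infty (m : nat) f : Prop :=
  (forall P : option k, (0 < ord_form P f)%R -> P = None) /\
  ord_form None f = m%:Z - 1.

End RationalFunctions.

Section FpSpaces.
Variables (p : nat) (V : zmodType).
Implicit Types (Omega : V -> Prop).

(* When p is prime and p kills V, the action of c : 'F_p on V is
   x |-> x *+ c, where c coerces to its representative in [0, p). *)
Definition Fp_subspace Omega : Prop :=
  [/\ Omega 0,
      forall x y, Omega x -> Omega y -> Omega (x + y) &
      forall (c : 'F_p) x, Omega x -> Omega (x *+ c)].

Definition Fp_basis (n : nat) Omega (e : 'I_n -> V) : Prop :=
  [/\ forall i, Omega (e i),
      forall c : 'I_n -> 'F_p, \sum_i e i *+ c i = 0 -> forall i, c i = 0 &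
      forall x, Omega x -> exists c : 'I_n -> 'F_p, x = \sum_i e i *+ c i].

Definition Fp_space_of_dim (n : nat) Omega : Prop :=
  Fp_subspace Omega /\ exists e : 'I_n -> V, Fp_basis Omega e.

End FpSpaces.

(* Omega is a space L_{m+1,n} over k, a field of characteristic p. *)
Definition space_L (p : nat) (k : fieldType) (m n : nat)
    (Omega : ratfun k -> Prop) : Prop :=
  Fp_space_of_dim p n Omega /\
  forall w : ratfun k, Omega w -> w != 0 ->
    logarithmic w /\ unique_zero_at_infty m w.

(* Main.v *)
(** Write the two forms of a basis as dX/P1 and dX/P2.  Dividing by the gcd gives
    coprime A, B of degree lambda whose leading coefficients are independent over
    F_p, and P2 is proportional to A^p - A B^(p-1), the product of the A + t B
    with t in F_p.  Hence P2' is proportional to B^(p-2) w, where w is the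
    Wronskian of A and B, and the residues lie in F_p^* exactly when
    (P2')^(p-1) = 1 at the roots of P2.

    Multiply these residues over the roots of A + t B for a fixed t in F_p.
    Exchanging the roots of A + t B with those of B and of w turns the product
    into a quotient f(t)/g(t), up to a constant, where f has degree at most
    2 lambda, g(t) = (a^p + b^p t)^lambda, and a, b are the leading coefficients of
    A, B.  So c f^(Frob) g and g^(Frob) f agree at all p points of F_p; their
    degree is at most 3 lambda < p, so they are equal.  Thus -(a/b)^p is a root
    of f of multiplicity at least lambda, which says that the map A/B of degree
    lambda has ramification at least lambda above one point; tameness bounds
    this ramification by lambda - 1. *)

Require Import Defs.
From mathcomp Require Import all_boot all_order all_algebra.
From mathcomp Require Import separable ring zify.

Set Implicit Arguments.
Unset Strict Implicit.
Unset Printing Implicit Defensive.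

Import GRing.Theory Order.Theory.
Local Open Scope ring_scope.
Local Open Scope quotient_scope.

(** * Rational functions *)

Lemma logderiv_cross (K : fieldType) (n u v t : K) : u != 0 -> v != 0 ->
  n / v ^+ 2 / (u / v) * t = 1 -> n * t = u * v.
Proof. by move=> u0 v0 E; rewrite -[RHS]mulr1 -E; field; rewrite u0 v0. Qed.

Section RationalFunctions.
Variable k : fieldType.
Implicit Types (f : ratfun k) (p q : {poly k}) (a : k).

Lemma rden_neq0 f : rden f != 0.
Proof. exact: denom_ratioP. Qed.

Lemma ratfun_numden f : f = (rnum f)%:F / (rden f)%:F.
Proof.
have dF : (rden f)%:F != 0 by rewrite tofrac_eq0 rden_neq0.
apply: (mulIf dF); rewrite divfK //.
rewrite /rnum /rden -{1}[f]reprK; move: (repr f) => x.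
unlock FracField.tofrac; rewrite -[LHS]FracField.pi_mul.
apply/eqP; rewrite FracField.equivf_def /FracField.mulf.
by rewrite !numden_Ratio ?oner_neq0 ?mulr1 ?denom_ratioP // mulrC.
Qed.

Lemma rnum_eq0 f : (rnum f == 0) = (f == 0).
Proof.
rewrite [in RHS](ratfun_numden f) mulf_eq0 invr_eq0 !tofrac_eq0.
by rewrite (negPf (rden_neq0 f)) orbF.
Qed.

(** The chosen representative need not be reduced; comparing it with an arbitrary fraction for [f]
    makes orders computable from any numerator and denominator. *)
Lemma rnum_rden_cross f p q : f * q%:F = p%:F -> rnum f * q = p * rden f.
Proof.
move=> E; have d0F : (rden f)%:F != 0 by rewrite tofrac_eq0 rden_neq0.
have N : (rnum f)%:F = f * (rden f)%:F 
  by have := congr1 ( *%R^~ (rden f)%:F) (ratfun_numden f); rewrite /= divfK.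
apply/eqP; rewrite -tofrac_eq; apply/eqP.
by rewrite (tofracM (rnum f)) (tofracM p) -E N mulrAC.
Qed.

Lemma rnum_neq0 f p q : p != 0 -> f * q%:F = p%:F -> rnum f != 0.
Proof.
move=> p0 E; rewrite rnum_eq0; apply: contraNneq p0 => f0.
by rewrite -tofrac_eq0 -E f0 mul0r.
Qed.

Lemma ord_rat_frac a f p q : p != 0 -> q != 0 -> f * q%:F = p%:F ->
  ord_rat a f = (mup a p)%:Z - (mup a q)%:Z.
Proof.
move=> p0 q0 Ef; have E := rnum_rden_cross Ef; have n0 := rnum_neq0 p0 Ef.
have := congr1 (mup a) E; rewrite !mupM ?rden_neq0 // => /(congr1 Posz).
rewrite !PoszD /ord_rat => Em; apply/eqP; rewrite subr_eq.
by rewrite addrAC eq_sym subr_eq -Em.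
Qed.

Lemma poly_at_XinvE q : poly_at_Xinv q =
  (\poly_(i < size q) q`_((size q).-1 - i))%:F / ('X^((size q).-1))%:F.
Proof.
have X0 : ('X : {poly k})%:F != 0 by rewrite tofrac_eq0 polyX_eq0.
apply: canRL (mulfK _) _; first by rewrite tofrac_eq0 monic_neq0 ?monicXn.
rewrite /poly_at_Xinv.
rewrite -[map_poly _ q]/(map_poly (@FracField.tofrac _ \o polyC) q).
rewrite horner_coef size_map_poly poly_def rmorph_sum mulr_suml /=.
rewrite [RHS](reindex_inj rev_ord_inj) /=; apply: eq_bigr => i _.
have lti := ltn_ord i; have lei : (i <= (size q).-1)%N.
  by rewrite -ltnS (ltn_predK lti).
have rev_i : (size q - i.+1 = (size q).-1 - i)%N by rewrite subnS predn_sub.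
rewrite coef_map /= -mul_polyC tofracM !tofracXn -mulrA; congr (_ * _).
  by congr (_ %:P %:F)%R; congr (_ `_ _); rewrite rev_i subKn.
rewrite exprVn mulrC rev_i -[X in 'X%:F ^+ X / _](subnK lei) exprD.
by rewrite mulfK ?expf_neq0.
Qed.

(** Substituting 1/X reverses the coefficients. The constant term of a reversed polynomial is the
    old leading coefficient, so it does not vanish at 0 and only the powers of X count. *)
Lemma ord_rat_at_Xinv f p q : p != 0 -> q != 0 -> f * q%:F = p%:F ->
  ord_rat 0 (rat_at_Xinv f) = (size q)%:Z - (size p)%:Z.
Proof.
move=> p0 q0 Ef; have E := rnum_rden_cross Ef; have n0 := rnum_neq0 p0 Ef.
have d0 := rden_neq0 f.
pose rv (r : {poly k}) := \poly_(i < size r) r`_((size r).-1 - i).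
have rvN r : r != 0 -> ~~ root (rv r) 0.
  move=> r0; rewrite /root horner_coef0 coef_poly lt0n size_poly_eq0 r0.
  by rewrite subn0 -lead_coefE lead_coef_eq0.
have rv0 r : r != 0 -> rv r != 0.
  by move/rvN; apply: contraNneq => ->; rewrite root0.
have X0 n : 'X^n != 0 :> {poly k} by rewrite monic_neq0 ?monicXn.
have mX n : mup 0 ('X^n : {poly k}) = n.
  by have := mup_XsubCX n (0 : k) 0; rewrite subr0 eqxx.
have F0 (r : {poly k}) : r != 0 -> r%:F != 0 by rewrite tofrac_eq0.
have Ei : rat_at_Xinv f * (rv (rden f) * 'X^((size (rnum f)).-1))%:F =
    (rv (rnum f) * 'X^((size (rden f)).-1))%:F.
  rewrite /rat_at_Xinv !poly_at_XinvE -/(rv _) -/(rv _) !tofracM.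
  by rewrite invf_div mulf_div [X in _ * X]mulrC divfK ?mulf_neq0 ?F0 ?rv0.
rewrite (ord_rat_frac _ _ _ Ei) ?mulf_neq0 ?rv0 // !mupMr ?rvN // !mX.
have := congr1 (size : {poly k} -> nat) E; rewrite !size_mul //.
move: p0 q0 n0 d0; rewrite -!size_poly_gt0.
move: (size p) (size q) (size (rnum f)) (size (rden f)) => *; lia.
Qed.

(** Here [s] is the full power of X - x in [p], with exponent m. The form s' (X - x) = m s avoids
    the exponent m - 1 and so covers m = 0. *)
Lemma root_part x p : p != 0 -> exists (m : nat) (p1 s : {poly k}),
  [/\ ~~ root p1 x, s != 0, p = p1 * s & s^`() * ('X - x%:P) = s *+ m].
Proof.
move=> p0; case: (multiplicity_XsubC p x) => m [p1]; rewrite p0 /= => p1x Ep.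
exists m, p1, (('X - x%:P) ^+ m); split=> //.
  by rewrite expf_neq0 ?polyXsubC_eq0.
rewrite deriv_exp derivXsubC mul1r mulrnAl.
by case: m {Ep} => [|m]; rewrite ?mulr0n //= -exprSr.
Qed.

(** The residue of dF/F at x is the order of F there, an integer, while that of dX/q is 1/q'(x). The
    equation obtained also shows that the root is simple. *)
Lemma logarithmic_residue f q x : f * q%:F = 1 -> logarithmic f -> root q x ->
  exists z : int, q^`().[x] * z%:~R = 1.
Proof.
move=> fq [F [F0 Ef]] /factor_theorem [q1 Eq].
have [U [V [U0 V0 Euv]]] : exists U V : {poly k},
    [/\ U != 0, V != 0 & (U^`() * V - U * V^`()) * q = U * V].
  exists (rnum F), (rden F); split; rewrite ?rden_neq0 ?rnum_eq0 //.
  have u0 : (rnum F)%:F != 0 by rewrite tofrac_eq0 rnum_eq0.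
  have v0 : (rden F)%:F != 0 by rewrite tofrac_eq0 rden_neq0.
  apply/eqP; rewrite -tofrac_eq (tofracM _ q) (tofracM (rnum F)); apply/eqP.
  apply: (logderiv_cross u0 v0).
  by rewrite -(tofracXn 2 (rden F)) -(ratfun_numden F) -/(rderiv F) -Ef.
have [m [U1 [A [U1x A0 EU EA]]]] := root_part x U0.
have [n [V1 [B [V1x B0 EV EB]]]] := root_part x V0.
exists (m%:Z - n%:Z).
have -> : q^`().[x] = q1.[x].
  by rewrite Eq derivM derivXsubC !hornerE subrr mulr0 add0r.
(* After cancelling the powers of X - x from numerator and denominator of F, only the terms with the
   orders m and n survive at x. *)
have {Euv} : U1 * V1 = q1 *
    ((U1 * V1) *+ m - (U1 * V1) *+ n + (U1^`() * V1 - U1 * V1^`()) * ('X - x%:P)).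
  apply: (mulIf (mulf_neq0 A0 B0)).
  rewrite [LHS]mulrACA -EU -EV -Euv EU EV Eq !derivM.
  move: (A^`()) (B^`()) ('X - x%:P) EA EB => A' B' C EA EB.
  transitivity (q1 * (U1 * V1 * B * (A' * C) - U1 * V1 * A * (B' * C)
    + (U1^`() * V1 - U1 * V1^`()) * C * A * B)); first by ring.
  by rewrite EA EB; ring.
move=> /(congr1 (horner^~ x)); rewrite !hornerE subrr mulr0 addr0 !hornerMn => E.
have uv0 : U1.[x] * V1.[x] != 0 by rewrite mulf_neq0.
apply: (mulIf uv0); rewrite mul1r [RHS]E intrB -!pmulrn.
by rewrite !hornerM; ring.
Qed.

End RationalFunctions.

(** In lowest terms, a root of the numerator would be a zero of [f]; over an algebraically closed
    field the numerator is therefore constant. *)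
Lemma no_finite_zero_inv (k : closedFieldType) (f : ratfun k) : f != 0 ->
  (forall a : k, (ord_rat a f <= 0)%R) -> exists2 q : {poly k}, q != 0 & f * q%:F = 1.
Proof.
move=> f0 ordf; set n := rnum f; set d := rden f.
have d0 : d != 0 := rden_neq0 f.
have n0 : n != 0 by rewrite rnum_eq0.
pose g := gcdp n d.
have g0 : g != 0 by rewrite gcdp_eq0 negb_and n0.
have En : n = n %/ g * g by rewrite divpK ?dvdp_gcdl.
have Ed : d = d %/ g * g by rewrite divpK ?dvdp_gcdr.
have cop : coprimep (n %/ g) (d %/ g) by rewrite coprimep_div_gcd ?n0.
move: (n %/ g) (d %/ g) En Ed cop => n1 d1 En Ed cop.
have n10 : n1 != 0 by apply: contraNneq n0 => z; rewrite En z mul0r.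
have d10 : d1 != 0 by apply: contraNneq d0 => z; rewrite Ed z mul0r.
have Ef : f * d1%:F = n1%:F.
  have gF : g%:F != 0 by rewrite tofrac_eq0.
  apply: (mulIf gF); rewrite -mulrA -!tofracM -En -Ed.
  by have := congr1 ( *%R^~ d%:F) (ratfun_numden f); rewrite /= divfK ?tofrac_eq0.
have /size_poly1P[c c0 Ec] : size n1 == 1.
  apply/negPn/negP => /closed_rootP[a n1a].
  have d1a : ~~ root d1 a by apply: (coprimep_root cop).
  have := ordf a; rewrite (ord_rat_frac a n10 d10 Ef) (mupNroot d1a) subr0.
  by rewrite leNgt ltz_nat -XsubC_dvd ?dvdp_XsubCl ?n1a.
exists (c^-1 *: d1); first by rewrite scaler_eq0 invr_eq0 negb_or c0.
by rewrite -mul_polyC tofracM mulrCA Ef Ec -tofracM -polyCM mulVf.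
Qed.

(** * Products over roots *)

Section Products.
Variable k : fieldType.

Lemma prod_const_mul (T : Type) (c : k) (F : T -> k) (r : seq T) :
  \prod_(x <- r) (c * F x) = c ^+ size r * \prod_(x <- r) F x.
Proof.
rewrite big_split /=; congr (_ * _).
by elim: r => [|x r IH]; rewrite ?big_nil // big_cons IH exprS.
Qed.

(** Both sides are the resultant of F and H: each product expands into the double product of the
    differences x - y, and reversing them all gives the sign. *)
Lemma prod_horner_swap (a b : k) (r s : seq k) (F H : {poly k}) :
  F = a *: \prod_(x <- r) ('X - x%:P) -> H = b *: \prod_(y <- s) ('X - y%:P) ->
  (\prod_(x <- r) H.[x]) * a ^+ size s =
  (-1) ^+ (size r * size s) * b ^+ size r * \prod_(y <- s) F.[y].
Proof.
move=> -> ->.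
have hE c z (q : seq k) :
    (c *: \prod_(x <- q) ('X - x%:P)).[z] = c * \prod_(x <- q) (z - x).
  by rewrite hornerZ horner_prod; congr (_ * _); apply: eq_bigr => x _; rewrite !hornerE.
rewrite (eq_bigr _ (fun x _ => hE b x s)) [in RHS](eq_bigr _ (fun y _ => hE a y r)).
rewrite !prod_const_mul exchange_big /=.
have -> : \prod_(y <- s) \prod_(x <- r) (y - x) =
    (-1) ^+ (size r * size s) * \prod_(y <- s) \prod_(x <- r) (x - y).
  rewrite exprM -prod_const_mul; apply: eq_bigr => y _.
  by rewrite -prod_const_mul; apply: eq_bigr => x _; ring.
set e := (-1) ^+ _; set Z := \prod_(y <- s) _.
have ee : e * e = 1 by rewrite -expr2 sqrr_sign.
transitivity (e * e * (b ^+ size r * Z * a ^+ size s)); first by rewrite ee mul1r.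
by ring.
Qed.

Lemma mup_scale (x c : k) (q : {poly k}) : c != 0 -> mup x (c *: q) = mup x q.
Proof. by move=> c0; rewrite -mul_polyC mupMr // rootC. Qed.

Lemma mup_linear (x : k) (l : {poly k}) : l != 0 -> (size l <= 2)%N ->
  (mup x l <= root l x)%N.
Proof.
move=> l0 sl; have [_|/mupNroot -> //] := boolP (root l x).
rewrite mup_leq //; apply/negP => /dvdp_leq -/(_ l0).
by rewrite size_exp_XsubC ltnNge sl.
Qed.

Lemma mup_prod_linear (T : eqType) (x : k) (l : T -> {poly k}) (r : seq T) :
  (forall y, l y != 0) -> (forall y, (size (l y) <= 2)%N) ->
  (mup x (\prod_(y <- r) l y) <= count (fun y => root (l y) x) r)%N.
Proof.
move=> l0 sl; elim: r => [|y r IH].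
  by rewrite big_nil mupNroot // root1.
rewrite big_cons mupM ?l0 ?prodf_seq_neq0 //=.
  by rewrite leq_add // mup_linear.
by apply/allP => z _; rewrite l0.
Qed.

Lemma size_prod_linear (T : Type) (l : T -> {poly k}) (r : seq T) :
  (forall y, (size (l y) <= 2)%N) -> (size (\prod_(y <- r) l y)%R <= (size r).+1)%N.
Proof.
move=> sl; elim: r => [|y r IH]; first by rewrite big_nil size_poly1.
rewrite big_cons (leq_trans (size_polyMleq _ _)) //=.
by rewrite -subn1 leq_subLR -[X in (_ <= X)%N]/(2 + (size r).+1)%N leq_add ?sl.
Qed.

Lemma size_exp_linear (l : {poly k}) n : (size l <= 2)%N -> (size (l ^+ n)%R <= n.+1)%N.
Proof.
move=> sl; rewrite (leq_trans (size_poly_exp_leq _ _)) // ltnS.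
by rewrite -[X in (_ <= X)%N]mul1n leq_mul2r -subn1 leq_subLR sl orbT.
Qed.

End Products.

(** * Ramification of a pencil *)

Definition wronskian (R : nzRingType) (A B : {poly R}) := A^`() * B - A * B^`().

Section CharP.
Variables (k : closedFieldType) (p : nat).
Hypothesis hchar : p \in [pchar k].
Implicit Types (A B E w : {poly k}).

Lemma natr_neq0_lt_pchar n : (0 < n < p)%N -> n%:R != 0 :> k.
Proof.
by move=> /andP[n0 np]; rewrite -(dvdn_pcharf hchar) gtnNdvd.
Qed.

Lemma natr_inj_lt_pchar m n : (m < p)%N -> (n < p)%N -> m%:R = n%:R :> k -> m = n.
Proof.
wlog le_mn : m n / (m <= n)%N.
  move=> H mp np E; case: (leqP m n) => [|/ltnW] le; first exact: H.
  by apply/esym/H.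
move=> mp np E; apply/eqP; rewrite eqn_leq le_mn leqNgt; apply/negP => lt_mn.
have /negP[] : (n - m)%:R != 0 :> k by apply: natr_neq0_lt_pchar; lia.
by rewrite natrB // E subrr.
Qed.

Definition prime_field_seq : seq k := [seq n%:R | n <- iota 0 p].

Lemma prime_field_seq_uniq : uniq prime_field_seq.
Proof.
rewrite map_inj_in_uniq ?iota_uniq // => m n; rewrite !mem_iota /= !add0n.
exact: natr_inj_lt_pchar.
Qed.

Lemma natr_exp_pchar n : n%:R ^+ p = n%:R :> k.
Proof. by rewrite -(pFrobenius_autE hchar) pFrobenius_aut_nat. Qed.

(** The polynomial X^p - X already has the p elements of the prime field as roots, which leaves no
    room for another. *)
Lemma Frobenius_fixed (b : k) : b ^+ p = b -> b \in prime_field_seq.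
Proof.
move=> bp; apply/negPn/negP => nb.
have p1 : (1 < p)%N by rewrite prime_gt1 ?(pcharf_prime hchar).
have sz : size ('X^p - 'X : {poly k}) = p.+1.
  by rewrite size_polyDl size_polyXn // size_polyN size_polyX ltnS.
have : 'X^p - 'X = 0 :> {poly k}.
  apply: (@roots_geq_poly_eq0 _ _ (b :: prime_field_seq)).
  - apply/allP => x; rewrite in_cons /root !hornerE => /orP[/eqP ->|].
      by rewrite bp subrr.
    by case/mapP => n _ ->; rewrite natr_exp_pchar subrr.
  - by rewrite cons_uniq nb prime_field_seq_uniq.
  - by rewrite sz /= size_map size_iota.
by move/(congr1 (size : {poly k} -> nat)); rewrite sz size_poly0.
Qed.

(** Replacing A by E does not change the Wronskian. At a root of E of multiplicity m, both E' and E'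
    B - E B' vanish to order exactly m - 1, because 0 < m < p (tameness) and B(y) is nonzero. *)
Lemma mup_wronskian_root A B E y (c : k) : E = A + c *: B -> E != 0 ->
  (size E <= p)%N -> root E y -> ~~ root B y ->
  mup y (wronskian A B) = mup y E^`().
Proof.
move=> EE E0 sE Ey By.
have -> : wronskian A B = E^`() * B - E * B^`().
  by rewrite EE /wronskian derivD derivZ; rewrite -!mul_polyC; ring.
case: (multiplicity_XsubC E y) => m [E1]; rewrite E0 /= => E1y Em.
have m0 : (0 < m)%N.
  by rewrite lt0n; apply/eqP => m0; move: Ey; rewrite Em m0 expr0 mulr1 (negPf E1y).
have mp : (m < p)%N.
  apply: leq_trans sE; rewrite -(size_exp_XsubC m y).
  by apply: dvdp_leq => //; rewrite Em dvdp_mull.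
case: m m0 mp Em => // m _ mp Em.
pose D := E1^`() * ('X - y%:P) + E1 *+ m.+1.
have EE' : E^`() = D * ('X - y%:P) ^+ m.
  by rewrite Em derivM deriv_exp derivXsubC /D /= exprS; ring.
have Dy : ~~ root D y.
  rewrite /root !hornerE subrr mulr0 add0r hornerMn -mulr_natl mulf_eq0 negb_or E1y.
  by rewrite natr_neq0_lt_pchar.
have -> : E^`() * B - E * B^`() =
    (D * B - E1 * B^`() * ('X - y%:P)) * ('X - y%:P) ^+ m.
  by rewrite EE' Em exprS; ring.
rewrite EE' !mupMr //.
by rewrite /root hornerD hornerN !hornerM hornerXsubC subrr mulr0 subr0 mulf_neq0.
Qed.

(** The roots of E among those of the Wronskian are, with multiplicity, roots of E'. Since deg E <
    p, E' is nonzero, and its degree is at most deg E - 1. *)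
Lemma count_wronskian_roots A B E (c w0 : k) (r : seq k) :
  coprimep A B -> E = A + c *: B -> (1 < size E)%N -> (size E <= p)%N -> w0 != 0 ->
  wronskian A B = w0 *: \prod_(y <- r) ('X - y%:P) ->
  ((count (root E) r).+1 < size E)%N.
Proof.
move=> cop EE sE1 sEp w00 Ew.
have E0 : E != 0 by rewrite -size_poly_gt0; lia.
have E'0 : E^`() != 0.
  have : E^`()`_(size E).-2 != 0.
    rewrite coef_deriv -mulr_natl mulf_neq0 //.
      by apply: natr_neq0_lt_pchar; lia.
    have -> : ((size E).-2.+1 = (size E).-1)%N by lia.
    by rewrite -lead_coefE lead_coef_eq0.
  by apply: contraNneq => ->; rewrite coef0.
have [s Es] := closed_field_poly_normal E^`().
have sEs : size E^`() = (size s).+1.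
  by rewrite Es size_scale ?lead_coef_eq0 // size_prod_XsubC.
suff : (size (filter (root E) r) <= size s)%N.
  by have := lt_size_deriv E0; rewrite size_filter sEs; lia.
have : forall y, (count_mem y (filter (root E) r) <= count_mem y s)%N.
  move=> y; rewrite count_filter.
  have [Ey|nEy] := boolP (root E y); last first.
    rewrite (eq_count (a2 := pred0)) ?count_pred0 // => x /=.
    by case: eqP => // ->; rewrite (negPf nEy).
  rewrite (eq_count (a2 := pred1 y)); last first.
    by move=> x /=; case: eqP => // ->.
  have By : ~~ root B y.
    apply/negP => By; have Ay : root A y.
      move: Ey By; rewrite EE /root !hornerE => /eqP H /eqP B0.
      by rewrite -H B0 mulr0 addr0.
    by have := coprimep_root cop Ay; rewrite (eqP By) eqxx.
  rewrite -!mu_prod_XsubC -(mup_scale _ _ w00) -Ew.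
  rewrite (mup_wronskian_root EE E0 sEp Ey By).
  by rewrite {1}Es mup_scale ?lead_coef_eq0.
by move/count_subseqP => [s' /size_subseq ss' /perm_size ->].
Qed.

End CharP.

(** * Residues along a pencil *)

Section Pencil.
Variables (k : closedFieldType) (p : nat).
Hypothesis hchar : p \in [pchar k].
Implicit Types (A B E w : {poly k}).

Lemma sign_exp_pred_pchar e : (2 < p)%N -> ((-1) ^+ e) ^+ p.-1 = 1 :> k.
Proof.
move=> p2; rewrite exprAC -signr_odd.
have -> : odd p.-1 = false.
  case: (even_prime (pcharf_prime hchar)) p2 => [-> //|].
  by case: (p) => //= n; case: (odd n).
by rewrite expr0 expr1n.
Qed.

(** The size condition says that the leading coefficients are independent over F_p. The expression
    with [u] is the derivative of [P2], so the last condition puts the residues of dX/P2 in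
    F_p^*. *)
Lemma no_pencil_with_Fp_residues (l : nat) A B (u : k) :
  (0 < l)%N -> (3 * l < p)%N -> coprimep A B ->
  size A = l.+1 -> size B = l.+1 ->
  (forall n, (n < p)%N -> size (A + B *+ n) = l.+1) ->
  (forall n x, (n < p)%N -> root (A + B *+ n) x ->
    (u * B.[x] ^+ (p - 2) * (wronskian A B).[x]) ^+ p.-1 = 1) ->
  False.
Proof.
move=> l0 lp cop sA sB sAB res.
have p2 : (2 < p)%N by lia.
have p_gt0 : (0 < p)%N by lia.
have nzroot n x : (n < p)%N -> root (A + B *+ n) x ->
    u * B.[x] ^+ (p - 2) * (wronskian A B).[x] != 0.
  move=> np rx; apply/eqP => z; have := res n x np rx.
  have p10 : (p.-1 == 0)%N = false by lia.
  by move/eqP; rewrite z expr0n p10 eq_sym oner_eq0.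
(* A root of the member n = 0 shows that the Wronskian is not identically zero. *)
have [x Ax] : exists x, root A x by apply/closed_rootP; rewrite sA; lia.
have := nzroot 0%N x p_gt0; rewrite mulr0n addr0 => /(_ Ax).
rewrite !mulf_eq0 !negb_or -andbA => /and3P[_ _ wx].
have w0 : wronskian A B != 0 by apply: contraNneq wx => ->; rewrite horner0.
set w := wronskian A B in w0 *.
have [rw Ew] := closed_field_poly_normal w.
have [rB EB] := closed_field_poly_normal B.
set w_ := lead_coef w in Ew; set b := lead_coef B in EB.
have w_0 : w_ != 0 by rewrite lead_coef_eq0.
have B0 : B != 0 by rewrite -size_poly_eq0 sB.
have b0 : b != 0 by rewrite lead_coef_eq0.
have srB : size rB = l.
  by have := sB; rewrite EB size_scale // size_prod_XsubC => -[].
pose a := lead_coef A; pose d := size rw.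
have dl : (d <= 2 * l)%N.
  suff : (size w <= 2 * l)%N by rewrite Ew size_scale // size_prod_XsubC => /ltnW.
  rewrite (leq_trans (size_polyD _ _)) // size_polyN geq_max.
  have sd (q : {poly k}) : size q = l.+1 -> (size q^`() <= l)%N.
    by move=> sq; rewrite -ltnS -sq lt_size_deriv // -size_poly_eq0 sq.
  rewrite !(leq_trans (size_polyMleq _ _)) // ?sA ?sB.
    by rewrite addSn /= mul2n -addnn leq_add2l sd.
  by rewrite addnS /= mul2n -addnn leq_add2r sd.
(* As polynomials in t, [lin y] is the value of A + t B at y and [L] is the leading coefficient of A
   + t B. *)
pose lin (y : k) : {poly k} := A.[y]%:P + B.[y] *: 'X.
pose L : {poly k} := a%:P + b *: 'X.
have slin (c e : k) : (size (c%:P + e *: 'X)%R <= 2)%N.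
  rewrite (leq_trans (size_polyD _ _)) // geq_max.
  rewrite (leq_trans (size_polyC_leq1 _)) //=.
  by rewrite (leq_trans (size_scale_leq _ _)) // size_polyX.
have lin0 y : lin y != 0.
  apply/eqP => /polyP H.
  have Ay : root A y by have := H 0%N; rewrite !coefE mulr0 addr0 /root => ->.
  have := coprimep_root cop Ay; have := H 1%N.
  by rewrite !coefE mulr1 add0r => ->; rewrite eqxx.
pose De := \prod_(y <- rw) lin y.
(* Exchanging roots leaves the denominator L(t)^(l(p-2)+d). The extra power of [L] completes it to
   L(t)^(lp), which for t in F_p equals g(t), of degree only l. *)
pose f := De * L ^+ (2 * l - d).
pose g := ((a ^+ p)%:P + (b ^+ p) *: 'X) ^+ l.
pose phi := pFrobenius_aut hchar.
pose cB := b ^+ l * \prod_(y <- rB) A.[y].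
pose c := u ^+ l * cB ^+ (p - 2) * w_ ^+ l.
(* The product of the residues over the roots of A + n B, with the roots
   exchanged; raising to the even power p - 1 removes the signs. *)
have key n : (n < p)%N -> (c * f.[n%:R]) ^+ p.-1 = g.[n%:R] ^+ p.-1.
  move=> np; set t : k := n%:R; set Q := A + B *+ n.
  have [r EQ] := closed_field_poly_normal Q; set q := lead_coef Q in EQ.
  have Q0 : Q != 0 by rewrite -size_poly_eq0 sAB.
  have q0 : q != 0 by rewrite lead_coef_eq0.
  have sr : size r = l.
    by have := sAB n np; rewrite -/Q EQ size_scale // size_prod_XsubC => -[].
  have qE : q = a + t * b.
    by rewrite /q /a /b !lead_coefE sAB // sA sB coefD coefMn mulr_natl.
  have Qh y : Q.[y] = A.[y] + t * B.[y] by rewrite hornerD hornerMn mulr_natl.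
  have rr x1 : x1 \in r -> root Q x1.
    by move=> xr; rewrite EQ rootZ // root_prod_XsubC.
  have prod1 : (u ^+ l * (\prod_(x <- r) B.[x]) ^+ (p - 2) *
      \prod_(x <- r) w.[x]) ^+ p.-1 = 1.
    rewrite -{1}sr -mulrA -prodrXl -big_split -prod_const_mul /= -prodrXl big_seq.
    by apply: big1 => x1 /rr x1r; rewrite mulrA; apply: res np x1r.
  have swB := prod_horner_swap EQ EB.
  have swW := prod_horner_swap EQ Ew.
  rewrite srB sr in swB; rewrite sr -/d in swW.
  (* At a root of B the pencil takes the value A(y), so this factor does not depend on t. *)
  have QB : \prod_(y <- rB) Q.[y] = \prod_(y <- rB) A.[y].
    rewrite !big_seq; apply: eq_bigr => y yr.
    have : root B y by rewrite EB rootZ // root_prod_XsubC.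
    by rewrite Qh /root => /eqP ->; rewrite mulr0 addr0.
  have Deh : De.[t] = \prod_(y <- rw) Q.[y].
    rewrite /De horner_prod; apply: eq_bigr => y _.
    by rewrite Qh /lin !hornerE mulrC.
  have fh : f.[t] = De.[t] * q ^+ (2 * l - d).
    by rewrite /f hornerM horner_exp qE /L !hornerE [b * t]mulrC.
  have gh : g.[t] = q ^+ (l * p).
    rewrite /g horner_exp mulnC exprM; congr (_ ^+ _).
    rewrite -!(pFrobenius_autE hchar) qE rmorphD rmorphM /= /t pFrobenius_aut_nat.
    by rewrite !hornerE mulrC.
  rewrite QB -mulrA -/cB in swB; rewrite -Deh -mulrA in swW.
  set e1 := (-1) ^+ _ in swB; set e2 := (-1) ^+ _ in swW.
  have s1 : (e1 ^+ (p - 2)) ^+ p.-1 = 1 by rewrite exprAC sign_exp_pred_pchar // expr1n.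
  have s2 : e2 ^+ p.-1 = 1 by exact: sign_exp_pred_pchar.
  move: prod1 swB swW; set PB := \prod_(x <- r) _; set PW := \prod_(x <- r) _.
  move=> prod1 swB swW.
  have : (u ^+ l * (e1 * cB) ^+ (p - 2) * (e2 * (w_ ^+ l * De.[t]))
      * q ^+ (2 * l - d)) ^+ p.-1 = (q ^+ (l * p)) ^+ p.-1.
    rewrite -swB -swW.
    have -> : (l * p = l * (p - 2) + d + (2 * l - d))%N by nia.
    rewrite !exprD exprM [in RHS]exprMn [in RHS]exprMn.
    rewrite -[in RHS](mul1r (_ ^+ p.-1 * _ ^+ p.-1 * _)) -prod1 -!exprMn; congr (_ ^+ _).
    by rewrite exprMn; ring.
  rewrite gh fh => <-.
  transitivity (((e1 ^+ (p - 2)) ^+ p.-1 * e2 ^+ p.-1) *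
     (c * (De.[t] * q ^+ (2 * l - d))) ^+ p.-1); first by rewrite s1 s2 !mul1r.
  rewrite -!exprMn; congr (_ ^+ _); rewrite /c (exprMn _ e1 cB).
  by ring.
(* Multiplying [key] by f g turns (p-1)-th powers into p-th powers, and on F_p the p-th power of h
   is h with Frobenius applied to its coefficients. The degree thus stays at most 3l < p, and p
   roots force D = 0. *)
pose D := c ^+ p.-1 *: (map_poly phi f * g) - map_poly phi g * f.
have D0 : D = 0.
  apply: (@roots_geq_poly_eq0 _ _ (prime_field_seq k p)).
  - apply/allP => z /mapP[n]; rewrite mem_iota add0n => /andP[_ np] -> {z}.
    have ht (h : {poly k}) : (map_poly phi h).[n%:R] = h.[n%:R] ^+ p.
      by rewrite -[in LHS](pFrobenius_aut_nat hchar n) horner_map /= pFrobenius_autE.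
    rewrite /root /D hornerD hornerN hornerZ.
    rewrite (hornerM (map_poly _ f)) (hornerM (map_poly _ g)) !ht subr_eq0.
    have := key n np; move: (f.[n%:R]) (g.[n%:R]) => F G; rewrite exprMn => E.
    have Ep (z : k) : z ^+ p = z ^+ p.-1 * z by rewrite -exprSr prednK.
    rewrite !Ep -E; apply/eqP; ring.
  - exact: prime_field_seq_uniq.
  - rewrite size_map size_iota; apply: leq_trans lp.
    have sg : (size g <= l.+1)%N by apply: size_exp_linear.
    have sf : (size f <= (2 * l).+1)%N.
      rewrite (leq_trans (size_polyMleq _ _)) // -subn1 leq_subLR.
      have -> : (1 + (2 * l).+1 = d.+1 + (2 * l - d).+1)%N by lia.
      apply: leq_add; last exact/size_exp_linear/slin.
      by apply: size_prod_linear => y; apply: slin.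
    rewrite (leq_trans (size_polyD _ _)) // size_polyN geq_max.
    rewrite (leq_trans (size_scale_leq _ _)) //.
      rewrite (leq_trans (size_polyMleq _ _)) // -subn1 leq_subLR size_map_poly.
      have -> : (1 + (3 * l).+1 = l.+1 + (2 * l).+1)%N by lia.
      exact: leq_add sg sf.
    rewrite (leq_trans (size_polyMleq _ _)) // -subn1 leq_subLR size_map_poly.
    have -> : (1 + (3 * l).+1 = (2 * l).+1 + l.+1)%N by lia.
    exact: leq_add sf sg.
(* [be] is the root of [L] and [ta] the root of [g]. They differ: otherwise [be] would lie in F_p,
   and the member of the pencil at [be] would drop in degree. *)
pose be := - (a / b); pose ta := be ^+ p.
have aE : a = - (be * b) by rewrite /be mulNr opprK divfK.
have bta : ta != be.
  apply/eqP => /(Frobenius_fixed hchar)/mapP[n]; rewrite mem_iota add0n => /andP[_ np] En.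
  have := sAB n np => sn; have : (A + B *+ n)`_l != 0.
    by have := lead_coef_eq0 (A + B *+ n); rewrite lead_coefE sn /= -size_poly_eq0 sn => ->.
  have -> : (A + B *+ n)`_l = a + n%:R * b.
    by rewrite /a /b !lead_coefE sA sB coefD coefMn mulr_natl.
  by rewrite aE -En addNr eqxx.
pose E := A + ta *: B.
have El : E`_l = (ta - be) * b.
  rewrite coefD coefZ; have -> : B`_l = b by rewrite /b lead_coefE sB.
  have -> : A`_l = a by rewrite /a lead_coefE sA.
  by rewrite aE; ring.
have El0 : E`_l != 0 by rewrite El mulf_neq0 // subr_eq0.
have sE : (size E <= l.+1)%N.
  rewrite (leq_trans (size_polyD _ _)) // geq_max sA leqnn.
  by rewrite (leq_trans (size_scale_leq _ _)) // sB.
have sE1 : (l < size E)%N.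
  by rewrite ltnNge; apply: contra El0 => /leq_sizeP /(_ l (leqnn _)) ->.
(* The points y counted here are the ramification points of -A/B above ta. *)
have cnt : (l <= count (root E) rw)%N.
  have De0 : De != 0 by rewrite prodf_seq_neq0; apply/allP => y _; apply: lin0.
  have Lta : ~~ root L ta.
    rewrite /root /L !hornerE aE addrC [b * _]mulrC -mulrBl mulf_neq0 // subr_eq0 //.
  have gE : g = b ^+ p ^+ l *: ('X - ta%:P) ^+ l.
    rewrite /g -exprZn; congr (_ ^+ _).
    rewrite aE -(pFrobenius_autE hchar) rmorphN rmorphM /= !pFrobenius_autE -/ta.
    by rewrite scalerBr -!mul_polyC -!polyCM polyCN [ta * _]mulrC addrC.
  have g0 : g != 0 by rewrite gE scaler_eq0 negb_or !expf_neq0 ?polyXsubC_eq0.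
  (* Since [ta] is the Frobenius image of [be], this amounts to g(be) being nonzero, and the only
     root of [g] is [ta]. *)
  have pgta : ~~ root (map_poly phi g) ta.
    rewrite -[ta](pFrobenius_autE hchar) -/phi fmorph_root.
    rewrite gE rootZ ?expf_neq0 // /root horner_exp hornerXsubC expf_neq0 //.
    by rewrite subr_eq0 eq_sym.
  have pg0 : map_poly phi g != 0 by apply: contraNneq pgta => ->; rewrite root0.
  have f0 : f != 0.
    by rewrite mulf_neq0 ?expf_neq0 //; apply: contraNneq Lta => ->; rewrite root0.
  (* By D = 0 this product is a multiple of g, hence of (X - ta)^l. Neither the twisted g nor [L]
     vanishes at [ta], so [De] carries the whole multiplicity. *)
  have : (l <= mup ta (map_poly phi g * f))%N.
    rewrite mup_geq; last exact: mulf_neq0.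
    move/eqP: D0; rewrite subr_eq0 => /eqP <-.
    by rewrite -mul_polyC !dvdp_mull // gE -mul_polyC dvdp_mull.
  rewrite mupMr // /f mupMl; last by rewrite /root horner_exp expf_neq0.
  move/leq_trans; apply.
  rewrite (leq_trans (mup_prod_linear _ _ _ _)) //; first by move=> y; apply: slin.
  rewrite leq_eqVlt; apply/orP; left; apply/eqP; apply: eq_count => y.
  by rewrite /root /lin !hornerE mulrC.
have := count_wronskian_roots hchar cop (erefl E) _ _ w_0 Ew.
move=> /(_ (leq_ltn_trans l0 sE1)) H.
have {H} := H (leq_trans sE (leq_ltn_trans (leq_pmull l (isT : 0 < 3)%N) lp)).
by move=> /leq_trans /(_ sE); rewrite ltnS ltnNge cnt.
Qed.

End Pencil.

(** * From reciprocals of polynomials to pencils *)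

Lemma dvdp_prod_coprime (k : fieldType) (T : eqType) (F : T -> {poly k})
    (r : seq T) (q : {poly k}) :
  uniq r -> {in r &, forall x y, x != y -> coprimep (F x) (F y)} ->
  {in r, forall x, F x %| q} -> \prod_(x <- r) F x %| q.
Proof.
elim: r => [|x r IH] /=; first by rewrite big_nil dvd1p.
move=> /andP[xr ur] cop dv; rewrite big_cons Gauss_dvdp.
  rewrite dv ?mem_head //=; apply: IH => // [y z yr zr|y yr].
    by apply: cop; rewrite in_cons ?yr ?zr orbT.
  by apply: dv; rewrite in_cons yr orbT.
rewrite big_seq; elim/big_ind: _ => [|a b ca cb|y yr].
- exact: coprimep1.
- by rewrite coprimepMr ca.
- by apply: cop; rewrite ?mem_head // ?in_cons ?yr ?orbT //; apply: contraNneq xr => ->.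
Qed.

Lemma coprimep_no_common_root (k : closedFieldType) (P Q : {poly k}) :
  (forall x, root P x -> ~~ root Q x) -> coprimep P Q.
Proof.
move=> H; apply/coprimepP => d dP dQ; rewrite -size_poly_eq1; apply/negPn/negP.
move/closed_rootP => [x]; have := H x; rewrite -!dvdp_XsubCl => Hx dx.
by move: Hx; rewrite (dvdp_trans dx dP) (dvdp_trans dx dQ) => /(_ isT).
Qed.

Lemma size_prod_const (k : fieldType) (T : eqType) (F : T -> {poly k}) (r : seq T) e :
  {in r, forall x, size (F x) = e.+1} ->
  size (\prod_(x <- r) F x) = (e * size r).+1.
Proof.
elim: r => [|x r IH] H; first by rewrite big_nil size_poly1 muln0.
have sx := H x (mem_head _ _).
have sr : size (\prod_(x <- r) F x) = (e * size r).+1.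
  by apply: IH => y yr; apply: H; rewrite in_cons yr orbT.
have x0 : F x != 0 by rewrite -size_poly_eq0 sx.
have r0 : \prod_(x <- r) F x != 0 by rewrite -size_poly_eq0 sr.
by rewrite big_cons size_mul // sx sr /= mulnS addnS.
Qed.

Section Pair.
Variables (k : closedFieldType) (p : nat).
Hypothesis hchar : p \in [pchar k].

(** A common root of two members is a root of (m - n) B, hence of B and then of A. *)
Lemma coprimep_pencil (A B : {poly k}) m n : coprimep A B ->
  (m < p)%N -> (n < p)%N -> m != n -> coprimep (A + B *+ m) (A + B *+ n).
Proof.
move=> cop mp np mn.
apply: coprimep_no_common_root => x; rewrite /root !hornerD !hornerMn => /eqP Em.
apply/negP => /eqP En.
have : B.[x] * (m%:R - n%:R) = 0.
  by rewrite -[RHS](subrr 0) -{1}Em -En; ring.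
move/eqP; rewrite mulf_eq0 subr_eq0.
case/orP => [/eqP Bx|/eqP/(natr_inj_lt_pchar hchar mp np) E].
  have Ax : root A x by rewrite /root -Em Bx mul0rn addr0.
  by have := coprimep_root cop Ax; rewrite Bx eqxx.
by rewrite E eqxx in mn.
Qed.

(** The derivative of A^p vanishes and p - 1 = -1 in k. *)
Lemma deriv_Frobenius_pencil (A B : {poly k}) :
  (A ^+ p - A * B ^+ p.-1)^`() = - (B ^+ (p - 2) * wronskian A B).
Proof.
have p1 : (1 < p)%N by rewrite prime_gt1 ?(pcharf_prime hchar).
have pE : p.-1 = (p - 2).+1 by lia.
have pC (q : {poly k}) : q *+ p = 0.
  by rewrite -mulr_natr -polyC_natr (pcharf0 hchar) mulr0.
have pC1 (q : {poly k}) : q *+ p.-1 = - q.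
  by apply/eqP; rewrite -addr_eq0 -mulrSr prednK 1?ltnW // pC.
rewrite derivB derivM !deriv_exp pC pC1 pE /= exprS /wronskian; ring.
Qed.

(** The quotient -A(x)/B(x) is fixed by Frobenius, hence lies in F_p. *)
Lemma root_pencil (A B : {poly k}) x : coprimep A B ->
  A.[x] ^+ p.-1 = B.[x] ^+ p.-1 -> exists2 n, (n < p)%N & root (A + B *+ n) x.
Proof.
move=> cop E; have p1 : (1 < p)%N by rewrite prime_gt1 ?(pcharf_prime hchar).
have p10 : (p.-1 == 0)%N = false by lia.
have Bx : B.[x] != 0.
  apply/eqP => Bx; move/eqP: E; rewrite Bx expr0n p10 expf_eq0 => /andP[_ Ax].
  by have := coprimep_root cop Ax; rewrite Bx eqxx.
have /(Frobenius_fixed hchar)/mapP[n] : (- (A.[x] / B.[x])) ^+ p = - (A.[x] / B.[x]).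
  rewrite -(pFrobenius_autE hchar) pFrobenius_autN pFrobenius_autE; congr (- _).
  by rewrite -{1}[p]prednK 1?ltnW // exprS expr_div_n E divff ?expf_neq0 ?mulr1.
rewrite mem_iota add0n => /andP[_ np] En; exists n => //.
by rewrite /root hornerD hornerMn -mulr_natl -En mulNr divfK ?subrr.
Qed.

(** The last condition says that 1/P1 + n/P2 is again the reciprocal of a polynomial Q of degree l
    p. *)
Lemma no_reciprocal_pair (l : nat) (P1 P2 : {poly k}) :
  (0 < l)%N -> (3 * l < p)%N ->
  size P1 = (l * p).+1 -> size P2 = (l * p).+1 ->
  (forall x, root P1 x -> P1^`().[x] ^+ p.-1 = 1) ->
  (forall x, root P2 x -> P2^`().[x] ^+ p.-1 = 1) ->
  (forall n, (n < p)%N -> exists2 Q : {poly k}, size Q = (l * p).+1 &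
    (P2 + P1 *+ n) * Q = P1 * P2) ->
  False.
Proof.
move=> l0 lp s1 s2 res1 res2 comb.
have p_gt0 : (0 < p)%N by lia.
have p10 : (p.-1 == 0)%N = false by lia.
have P10 : P1 != 0 by rewrite -size_poly_eq0 s1.
have P20 : P2 != 0 by rewrite -size_poly_eq0 s2.
have [G [A [B [G0 E1 E2 cop]]]] : exists G A B : {poly k},
    [/\ G != 0, P1 = B * G, P2 = A * G & coprimep A B].
  exists (gcdp P2 P1), (P2 %/ gcdp P2 P1), (P1 %/ gcdp P2 P1); split.
  - by rewrite gcdp_eq0 negb_and P10 orbT.
  - by rewrite divpK ?dvdp_gcdr.
  - by rewrite divpK ?dvdp_gcdl.
  - by rewrite coprimep_div_gcd ?P20.
have A0 : A != 0 by apply: contraNneq P20 => z; rewrite E2 z mul0r.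
have B0 : B != 0 by apply: contraNneq P10 => z; rewrite E1 z mul0r.
pose e := (size B).-1.
have sB : size B = e.+1 by rewrite /e prednK // size_poly_gt0.
have sG : (e + size G = (l * p).+1)%N by rewrite -s1 E1 size_mul // sB.
have sA : size A = e.+1.
  have : (size A + size G = e.+1 + size G)%N.
    have := s2; rewrite E2 size_mul // -sG => /(congr1 S).
    by rewrite prednK // addn_gt0 size_poly_gt0 A0.
  by move/addIn.
(* Cancelling G gives (A + n B) Q = G A B. Degrees give the size; for n nonzero, A + n B is coprime
   to A and B, so it divides G. *)
have Cprop n : (n < p)%N -> size (A + B *+ n) = e.+1 /\
    ((0 < n)%N -> A + B *+ n %| G).
  move=> np; have [Q sQ EQ] := comb n np.
  have Q0 : Q != 0 by rewrite -size_poly_eq0 sQ.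
  have EG : (A + B *+ n) * Q = G * (A * B).
    apply: (mulIf G0); rewrite -[RHS]mulrA; transitivity (P1 * P2).
      by rewrite -EQ E1 E2; ring.
    by rewrite E1 E2; ring.
  have C0 : A + B *+ n != 0.
    apply/eqP => z; move/eqP: EG; rewrite z mul0r eq_sym !mulf_eq0.
    by rewrite (negPf G0) (negPf A0) (negPf B0).
  split.
    have := congr1 (size : {poly k} -> nat) EG.
    rewrite !size_mul ?mulf_neq0 // sQ sA sB -sG.
    have : (0 < size (A + B *+ n)%R)%N by rewrite size_poly_gt0.
    have : (0 < size G)%N by rewrite size_poly_gt0.
    move: (size G) (size (A + B *+ n)%R) => a b; lia.
  move=> n0.
  have cB : coprimep (A + B *+ n) B.
    apply: coprimep_no_common_root => x Cx; apply/negP => /eqP Bx.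
    have Ax : root A x by move: Cx; rewrite /root hornerD hornerMn Bx mul0rn addr0.
    by have := coprimep_root cop Ax; rewrite Bx eqxx.
  have cA : coprimep (A + B *+ n) A.
    have := coprimep_pencil cop np p_gt0 (lt0n_neq0 n0); by rewrite mulr0n addr0.
  by rewrite -(Gauss_dvdpl G (q := A * B)) ?coprimepMr ?cA // -EG dvdp_mulr.
have sAB n : (n < p)%N -> size (A + B *+ n) = e.+1 by move=> /Cprop[].
have prodG : \prod_(n <- iota 1 p.-1) (A + B *+ n) %| G.
  apply: dvdp_prod_coprime; first exact: iota_uniq.
    move=> m n; rewrite !mem_iota => /andP[_ mp] /andP[_ np].
    by apply: coprimep_pencil cop _ _; lia.
  by move=> n; rewrite mem_iota => /andP[n0 np]; apply: (Cprop n _).2; lia.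
(* The p - 1 pairwise coprime divisors of degree e give e (p - 1) <= deg G = l p - e. *)
have le_el : (e <= l)%N.
  have := dvdp_leq G0 prodG.
  have -> : size (\prod_(n <- iota 1 p.-1) (A + B *+ n)) = (e * p.-1).+1.
    rewrite -{2}[p.-1](size_iota 1); apply: size_prod_const => n.
    by rewrite mem_iota => /andP[_ np]; apply: sAB; lia.
  move: sG; move: (size G) => s; nia.
(* At a root of G, P1' = B G' and P2' = A G', and both have (p-1)-th power 1. In particular G is
   squarefree. *)
have rootG x : root G x -> G^`().[x] != 0 /\ A.[x] ^+ p.-1 = B.[x] ^+ p.-1.
  move=> Gx.
  have r1 := res1 x; have r2 := res2 x; move: r1 r2.
  rewrite E1 E2 /root !derivM !hornerE (eqP Gx) !mulr0 eqxx !add0r.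
  move=> /(_ isT) r1 /(_ isT) r2.
  have G'0 : G^`().[x] != 0.
    apply/eqP => z; move/eqP: r1; rewrite z mulr0 expr0n eq_sym.
    by rewrite p10 oner_eq0.
  split=> //.
  apply: (mulIf (expf_neq0 p.-1 G'0)); rewrite -!exprMn.
  by rewrite r1 r2.
have dvG : G %| A ^+ p.-1 - B ^+ p.-1.
  have [r Er] := closed_field_poly_normal G.
  rewrite Er dvdpZl ?lead_coef_eq0 //; apply: uniq_roots_dvdp.
    apply/allP => x xr; have Gx : root G x.
      by rewrite Er rootZ ?lead_coef_eq0 // root_prod_XsubC.
    by rewrite /root !hornerE (rootG x Gx).2 subrr.
  rewrite uniq_rootsE -separable_prod_XsubC -(eqp_separable (p := G)).
    rewrite separable_poly.unlock; apply: coprimep_no_common_root => x Gx.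
    by rewrite /root (rootG x Gx).1.
  by rewrite {1}Er eqp_scale ?lead_coef_eq0.
have dvQ : P2 %| A ^+ p - A * B ^+ p.-1.
  have -> : A ^+ p - A * B ^+ p.-1 = A * (A ^+ p.-1 - B ^+ p.-1).
    by rewrite mulrBr -exprS prednK.
  by rewrite E2 dvdp_mul2l.
(* G is nonconstant and each of its roots lies on some member of the pencil, so e > 0. At a root of
   A the two powers in the second factor then differ. *)
have Q0 : A ^+ p - A * B ^+ p.-1 != 0.
  have [x Gx] : exists x, root G x.
    by apply/closed_rootP; move: sG; case: eqP => // ->; nia.
  have [n np nx] := root_pencil cop (rootG x Gx).2.
  have C0 : A + B *+ n != 0 by rewrite -size_poly_eq0 sAB.
  have e0 : (0 < e)%N by have := root_size_gt1 C0 nx; rewrite sAB.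
  have [y Ay] : exists x, root A x by apply/closed_rootP; rewrite sA eqSS -lt0n.
  have -> : A ^+ p - A * B ^+ p.-1 = A * (A ^+ p.-1 - B ^+ p.-1).
    by rewrite mulrBr -exprS prednK.
  rewrite mulf_neq0 // subr_eq0; apply/eqP => /(congr1 (horner^~ y)).
  rewrite !horner_exp (eqP Ay) expr0n p10.
  by apply/eqP; rewrite eq_sym expf_neq0 //; apply: (coprimep_root cop).
have sQ : (size (A ^+ p - A * B ^+ p.-1)%R <= (e * p).+1)%N.
  rewrite (leq_trans (size_polyD _ _)) // size_polyN geq_max.
  rewrite (leq_trans (size_poly_exp_leq _ _)) ?sA //=.
  rewrite (leq_trans (size_polyMleq _ _)) // sA addSn /=.
  rewrite (leq_trans (leq_add (leqnn _) (size_poly_exp_leq _ _))) // sB /=.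
  by rewrite addnS -mulnS prednK.
have el : e = l.
  have := dvdp_leq Q0 dvQ; rewrite s2 => /leq_trans /(_ sQ); rewrite ltnS.
  by rewrite leq_pmul2r // => le; apply/eqP; rewrite eqn_leq le_el.
have [u Eu] : exists u : k, P2 = u *: (A ^+ p - A * B ^+ p.-1).
  have : P2 %= A ^+ p - A * B ^+ p.-1.
    rewrite -dvdp_size_eqp // eqn_leq dvdp_leq //=.
    by rewrite s2 (leq_trans sQ) // el.
  case/eqpP => -[c1 c2] /= /andP[c10 _] Ec; exists (c1^-1 * c2).
  by rewrite -scalerA -Ec scalerA mulVf // scale1r.
rewrite el in sA sB sAB.
(* The sign comes from the derivative of A^p - A B^(p-1). *)
apply: (no_pencil_with_Fp_residues hchar (u := - u) l0 lp cop sA sB sAB).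
move=> n x np rx.
have P2x : root P2 x.
  rewrite E2 rootM; case: n np rx => [|n] np rx.
    by rewrite mulr0n addr0 in rx; rewrite rx.
  have := (Cprop n.+1 np).2 isT; rewrite -!dvdp_XsubCl in rx *.
  by move/(dvdp_trans rx) ->; rewrite orbT.
have := res2 x P2x; congr (_ ^+ _ = _).
rewrite Eu derivZ deriv_Frobenius_pencil hornerZ hornerN hornerM horner_exp.
by ring.
Qed.

End Pair.

(** * From a space of forms to a pair of reciprocals *)

Lemma unique_zero_at_infty_inv (k : closedFieldType) m (f : ratfun k) : f != 0 ->
  unique_zero_at_infty m f -> exists2 q : {poly k}, size q = m.+2 & f * q%:F = 1.
Proof.
move=> f0 [fin inf].
have [|q q0 Eq] := no_finite_zero_inv f0.
  by move=> a; rewrite leNgt; apply/negP => H; have := fin (Some a) H.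
exists q => //; move: inf; rewrite /ord_form.
(* The order of dX/q at infinity is deg q - 2, so deg q = m + 1. *)
rewrite (ord_rat_at_Xinv (oner_neq0 _) q0); last by rewrite tofrac1.
by rewrite size_poly1; move: (size q) => s; lia.
Qed.

Lemma reciprocal_sum (R : comNzRingType) (w1 w2 q1 q2 q : R) n :
  w1 * q1 = 1 -> w2 * q2 = 1 -> (w1 + w2 *+ n) * q = 1 ->
  (q2 + q1 *+ n) * q = q1 * q2.
Proof.
move=> E1 E2 E; rewrite -[RHS]mul1r -E -[q2 in LHS]mul1r -[q1 in LHS]mul1r.
by rewrite -{1}E1 -E2; ring.
Qed.

Local Close Scope ring_scope.

Theorem theorem3p8 (lambda p : nat) (k : closedFieldType)
    (hlambda : 0 < lambda) (hp : prime p) (hlt : 3 * lambda < p)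
    (hchar : p \in [pchar k]%R) :
  ~ exists Omega : ratfun k -> Prop, space_L p (lambda * p).-1 2 Omega.
Proof.
case=> Omega [[[_ addO scalO] [e [eO freeE _]]] formO].
have lp0 : (0 < lambda * p)%N by rewrite muln_gt0 hlambda prime_gt0.
have inv w : Omega w -> (w != 0)%R -> exists2 q : {poly k},
    size q = (lambda * p).+1 & (w * q%:F = 1)%R.
  move=> wO w0; have [_ wz] := formO w wO w0.
  by have := unique_zero_at_infty_inv w0 wz; rewrite prednK.
have res w (q : {poly k}) : Omega w -> (w * q%:F = 1)%R ->
    forall x, root q x -> (q^`().[x] ^+ p.-1 = 1)%R.
  move=> wO Eq x qx.
  have w0 : (w != 0)%R.
    by apply/eqP => w0; move/eqP: Eq; rewrite w0 mul0r eq_sym oner_eq0.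
  have [wl _] := formO w wO w0.
  have [z Ez] := logarithmic_residue Eq wl qx.
  have z0 : (z%:~R != 0 :> k)%R.
    by apply/eqP => z0; move/eqP: Ez; rewrite z0 mulr0 eq_sym oner_eq0.
  (* The residue is the image of an integer, so Frobenius fixes it. *)
  have zp : (z%:~R ^+ p.-1 = 1 :> k)%R.
    apply: (mulIf z0); rewrite mul1r -exprSr prednK ?prime_gt0 //.
    by rewrite -(pFrobenius_autE hchar) pFrobenius_aut_int.
  by rewrite -[LHS]mulr1 -zp -exprMn Ez expr1n.
have valn n : (n < p)%N -> (n%:R : 'F_p)%R = n :> nat.
  by move=> np; rewrite val_Fp_nat // modn_small.
(* Scalars in F_p act through their representatives below p, so freeness applies to natural
   multiples c, d < p. *)
have comb_neq0 (c d : nat) : (c < p)%N -> (d < p)%N -> (0 < c + d)%N ->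
    (e ord0 *+ c + e (lift ord0 ord0) *+ d != 0)%R.
  move=> cp dp cd; apply/eqP => E.
  pose f (i : 'I_2) : 'F_p := (if i == ord0 then c%:R else d%:R)%R.
  have f0 : forall i, f i = 0%R.
    by apply: freeE; rewrite big_ord_recl big_ord1 /f /= !valn.
  have := congr1 (fun x : 'F_p => x : nat) (f0 ord0).
  have := congr1 (fun x : 'F_p => x : nat) (f0 (lift ord0 ord0)).
  by rewrite /f /= !valn // => d0 c0; rewrite c0 d0 in cd.
have p1 := prime_gt1 hp.
have e0 : (e ord0 != 0)%R by have := comb_neq0 1 0 p1 (ltnW p1) isT; rewrite addr0.
have e1 : (e (lift ord0 ord0) != 0)%R by have := comb_neq0 0 1 (ltnW p1) p1 isT; rewrite add0r.
have [P1 s1 E1] := inv _ (eO ord0) e0.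
have [P2 s2 E2] := inv _ (eO (lift ord0 ord0)) e1.
apply: (no_reciprocal_pair hchar hlambda hlt s1 s2 (res _ _ (eO _) E1) (res _ _ (eO _) E2)).
move=> n np.
have wO : Omega (e ord0 + e (lift ord0 ord0) *+ n)%R.
  by apply: addO; rewrite // -(valn n np); apply: scalO.
have w0 : (e ord0 + e (lift ord0 ord0) *+ n != 0)%R by apply: (comb_neq0 1 n).
have [Q sQ EQ] := inv _ wO w0; exists Q => //.
apply/eqP; rewrite -tofrac_eq; apply/eqP.
rewrite !tofracM tofracD tofracMn.
exact: reciprocal_sum E1 E2 EQ.
Qed.
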